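(* Let $\mathcal{A}$ be an irreducible Markovian automaton on $\tilde A$ whose support consists of reduced words, with coincidence probability $\alpha_{[2]}$, and let $(\mathbb{R}_n)_n$ be the sequence of probability measures it determines. If $\mathcal{A}$ does not consist of a single cycle, then there exists a constant $C>0$ such that $(\mathbb{R}_n)_n$ is prefix-heavy with parameters $(C,\alpha_{[2]}^{1/2})$.
   Context: $A$ is a finite non-empty alphabet, $\tilde A=A\sqcup A^{-1}$. A word over $\tilde A$ is reduced if it has no factor $aa^{-1}$ ($a\in\tilde A$); $\mathcal{R}$ is the set of reduced words (including the empty word), $\mathcal{R}_n$ those of length $n$. For $u\in\mathcal{R}$, $\mathcal{P}(u)$ is the set of reduced words having $u$ as a prefix (empty if $u$ is not reduced). A Markovian automaton $\mathcal{A}$ on $\tilde A$ consists of: a deterministic transition system $(Q,\cdot)$ with $Q$ a finite non-empty set of states and, for each $q\in Q$, $a\in\tilde A$, either $q\cdot a\in Q$ or $q\cdot a$ undefined; an initial probability vector $\gamma_0\in[0,1]^Q$, $\sum_q\gamma_0(q)=1$; and for each $p\in Q$ a probability vector $(\gamma(p,a))_{a\in\tilde A}$ with $\gamma(p,a)=0$ if and only if $p\cdot a$ is undefined. For a word $u=x_0\cdots x_n$, $\gamma(q,u)=\gamma(q,x_0)\gamma(q\cdot x_0,x_1)\cdots\gamma(q\cdot(x_0\cdots x_{n-1}),x_n)$ (equal to $1$ for $u$ empty), and $\gamma_0(u)=\sum_{q\in Q}\gamma_0(q)\gamma(q,u)$. The measure $\mathbb{R}_n$ on words of length $n$ is $\mathbb{R}_n(u)=\gamma_0(u)$;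 it is assumed that all words $u$ with $\gamma_0(u)\neq 0$ are reduced. $\mathcal{A}$ is irreducible if its transition graph is strongly connected. It consists of a single cycle if every state has exactly one outgoing transition (and the graph is strongly connected). Coincidence probability: let $Q'=\{(q,a)\in Q\times\tilde A:\exists p\in Q,\ p\cdot a=q\}$ and let $\mathbb{M}$ be the $Q'\times Q'$ matrix with $\mathbb{M}((p,a),(q,b))=\gamma(p,b)$ if $p\cdot b=q$ and $0$ otherwise. Let $\mathbb{M}_{[2]}$ be obtained from $\mathbb{M}$ by squaring each entry. Then $\alpha_{[2]}$ is the largest eigenvalue (spectral radius) of $\mathbb{M}_{[2]}$. A sequence $(\mathbb{R}_n)_{n\ge0}$ of probability measures on $\mathcal{R}$ is prefix-heavy with parameters $(C,\alpha)$ ($C\ge1$, $0<\alpha<1$) if (1) the support of $\mathbb{R}_n$ is contained in $\mathcal{R}_n$ for every $n$, and (2) for every $n\ge0$ and $u\in\mathcal{R}$ with $\mathbb{R}_n(\mathcal{P}(u))\ne0$, and every $v\in\mathcal{R}$, $\mathbb{R}_n(\mathcal{P}(uv)\mid\mathcal{P}(u))\le C\alpha^{|v|}$. *)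

(* Defs.v *)
From HB Require Import structures.
From mathcomp Require Export all_boot all_order all_algebra.
From mathcomp Require Export all_classical all_reals all_analysis.
From mathcomp Require Import complex.

Set Implicit Arguments.
Unset Strict Implicit.
Unset Printing Implicit Defensive.
Import Order.TTheory GRing.Theory Num.Theory.
Local Open Scope classical_set_scope.
Local Open Scope ring_scope.

(* The left summand is the alphabet, the right summand its formal inverses. *)
Definition letter (A : finType) : finType := (A + A)%type.

Definition letter_inv (A : finType) (a : letter A) : letter A :=
  match a with inl b => inr b | inr b => inl b end.

Definition word (A : finType) := seq (letter A).

HB.instance Definition _ (A : finType) := Choice.on (word A).
HB.instance Definition _ (A : finType) := isPointed.Build (word A) [::].
HB.instance Definition _ (A : finType) :=
  @isMeasurable.Build default_measure_display (word A) discrete_measurable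
    discrete_measurable0 discrete_measurableC discrete_measurableU.

Definition reduced (A : finType) (w : word A) : bool :=
  [forall a : letter A, ~~ infix [:: a; letter_inv a] w].

Definition reduced_with_prefix (A : finType) (u : word A) : set (word A) :=
  [set w | reduced w /\ prefix u w].

(* [step p a = None] means that the transition is undefined. *)
Record markov_automaton (R : realType) (A Q : finType) := MarkovAutomaton {
  step : Q -> letter A -> option Q;
  init : Q -> R;
  init_ge0 : forall q, 0 <= init q;
  init_sum1 : \sum_q init q = 1;
  trans : Q -> letter A -> R;
  trans_ge0 : forall p a, 0 <= trans p a;
  trans_sum1 : forall p, \sum_a trans p a = 1;
  trans_eq0 : forall p a, trans p a = 0 <-> step p a = None
}.

Section Automaton.
Context (R : realType) (A Q : finType) (M : markov_automaton R A Q).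

Fixpoint path_weight (q : Q) (u : word A) : R :=
  match u with
  | [::] => 1
  | x :: u' => trans M q x *
               (if step M q x is Some q' then path_weight q' u' else 0)
  end.

Definition word_weight (u : word A) : R :=
  \sum_q init M q * path_weight q u.

Lemma path_weight_ge0 q u : 0 <= path_weight q u.
Proof.
elim: u q => [|x u IH] q //=.
by apply: mulr_ge0; [exact: trans_ge0 | case: (step M q x)].
Qed.

Lemma word_weight_ge0 u : 0 <= word_weight u.
Proof.
by apply: sumr_ge0 => q _; rewrite mulr_ge0 ?init_ge0 ?path_weight_ge0.
Qed.

Lemma sum_path_weight n q :
  \sum_(w : n.-tuple (letter A)) path_weight q (w : seq _) = 1.
Proof.
elim: n q => [|n IH] q.
  rewrite (big_pred1 [tuple]) //= => w.
  by rewrite [w]tuple0 /= eqxx.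
rewrite (reindex (fun p : letter A * n.-tuple (letter A) =>
  [tuple of p.1 :: p.2])) /=; last first.
  exists (fun w => (thead w, [tuple of behead w])) => [[a w] _|w _] /=.
    by congr pair; apply: val_inj.
  by rewrite -tuple_eta.
rewrite -(pair_bigA _ (fun a (w : n.-tuple (letter A)) =>
  trans M q a * (if step M q a is Some q' then path_weight q' w else 0))) /=.
rewrite -[RHS](trans_sum1 M q); apply: eq_bigr => a _.
rewrite -mulr_sumr; case E: (step M q a) => [q'|].
  by rewrite IH mulr1.
by move/trans_eq0: E => ->; rewrite mul0r.
Qed.

Lemma sum_word_weight n :
  \sum_(w : n.-tuple (letter A)) word_weight (w : seq _) = 1.
Proof.
rewrite exchange_big /= -[RHS](init_sum1 M); apply: eq_bigr => q _.
by rewrite -mulr_sumr sum_path_weight mulr1.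
Qed.

Definition word_measure (n : nat) (S : set (word A)) : \bar R :=
  (\sum_(w : n.-tuple (letter A))
     (word_weight (w : seq _))%:E * \d_(w : word A) S)%E.

Section Instances.
Variable n : nat.

Let word_measure0 : word_measure n set0 = 0%E.
Proof. by rewrite /word_measure big1 // => w _; rewrite measure0 mule0. Qed.

Let word_measure_ge0 S : (0 <= word_measure n S)%E.
Proof.
by apply: sume_ge0 => w _; rewrite mule_ge0 ?lee_fin ?word_weight_ge0.
Qed.

Let word_measure_sigma_additive : semi_sigma_additive (word_measure n).
Proof.
move=> F mF tF mUF; rewrite [X in _ --> X](_ : _ =
  limn (fun k => \sum_(0 <= i < k) word_measure n (F i))%E).
  by apply: is_cvg_ereal_nneg_natsum => k _; exact: word_measure_ge0.
rewrite nneseries_sum; last first.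
  by move=> w i _; rewrite mule_ge0 ?lee_fin ?word_weight_ge0.
apply: eq_bigr => w _; rewrite nneseriesZl //.
by congr (_ * _)%E; apply/esym/cvg_lim => //; exact: measure_semi_sigma_additive.
Qed.

HB.instance Definition _ := isMeasure.Build _ _ _ (word_measure n)
  word_measure0 word_measure_ge0 word_measure_sigma_additive.

Let word_measure_setT : word_measure n setT = 1%E.
Proof.
rewrite /word_measure -(sum_word_weight n) -sumEFin.
by apply: eq_bigr => w _; rewrite diracT mule1.
Qed.

HB.instance Definition _ :=
  Measure_isProbability.Build _ _ _ (word_measure n) word_measure_setT.

Definition word_prob : probability (word A) R := word_measure n.

End Instances.

Definition support_reduced : Prop :=
  forall u : word A, word_weight u != 0 -> reduced u.

Definition edge : rel Q := [rel p q | [exists a, step M p a == Some q]].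

Definition irreducible : Prop := forall p q : Q, connect edge p q.

Definition single_cycle : Prop :=
  irreducible /\ forall q : Q, #|[set a | step M q a != None]%SET| = 1%N.

Definition entering : {set Q * letter A} :=
  [set qa : Q * letter A | [exists p, step M p qa.2 == Some qa.1]]%SET.

Definition transition_mx : 'M[R]_#|entering| :=
  \matrix_(i, j)
    let: (p, _) := enum_val i in let: (q, b) := enum_val j in
    if step M p b == Some q then trans M p b else 0.

Definition sq_transition_mx : 'M[R]_#|entering| :=
  map_mx (fun x => x ^+ 2) transition_mx.

End Automaton.

(* The spectrum is finite, and nonempty when [0 < n], so [sup] is a maximum. *)
Definition spectral_radius (R : realType) n (B : 'M[R]_n) : R :=
  sup [set ComplexField.Normc.normc z
         | z in [set z : complex R | eigenvalue (map_mx (real_complex R) B) z]].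

Definition coincidence_prob (R : realType) (A Q : finType)
    (M : markov_automaton R A Q) : R :=
  spectral_radius (sq_transition_mx M).

Definition cond_prob d (T : measurableType d) (R : realType)
    (P : probability T R) (X Y : set T) : R :=
  fine (P (X `&` Y)) / fine (P Y).

(* A probability measure on the set of reduced words is encoded as one on all
   words; [heavy_support] confines its mass to reduced words of length [n]. *)
Record prefix_heavy (R : realType) (A : finType)
    (P : nat -> probability (word A) R) (C alpha : R) : Prop := PrefixHeavy {
  heavy_C_ge1 : 1 <= C;
  heavy_alpha01 : 0 < alpha < 1;
  heavy_support : forall (n : nat) (w : word A),
    P n [set w] != 0%E -> reduced w /\ size w = n;
  heavy_bound : forall (n : nat) (u : word A), reduced u ->
    P n (reduced_with_prefix u) != 0%E ->
    forall v : word A, reduced v ->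
    cond_prob (P n) (reduced_with_prefix (u ++ v)) (reduced_with_prefix u)
      <= C * alpha ^+ size v
}.

(* Main.v *)
(* Let B be the matrix M_[2] and rho its spectral radius. If v leads from p to
   q, then gamma(p, v)^2 is one of the terms of an entry of B^|v|, so it
   suffices to bound the entries of B^k by a multiple of rho^k. Perron-Frobenius
   is not needed: B is irreducible, so an entry times a fixed positive constant
   is at most a diagonal entry of a later power, hence at most
   tr(B^m) = sum of the m-th powers of the eigenvalues <= n rho^m. A positive
   diagonal entry likewise gives rho > 0. Finally B is substochastic, and a state
   with two outgoing transitions has row sum < 1; by irreducibility some power
   of B has all its row sums < 1, whence rho < 1. *)

Require Import Defs.
From mathcomp Require Import spectral complex.

Set Implicit Arguments.
Unset Strict Implicit.
Unset Printing Implicit Defensive.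
Import Order.TTheory GRing.Theory Num.Theory.
Local Open Scope ring_scope.

(** * Powers, traces and eigenvalues of a square matrix *)

Lemma trig_mxX (S : pzRingType) n (T : 'M[S]_n) k :
  is_trig_mx T ->
  is_trig_mx (T ^+ k) /\ forall i, (T ^+ k) i i = T i i ^+ k.
Proof.
move=> /is_trig_mxP trigT; elim: k => [|k [/is_trig_mxP trigTk diagTk]].
  by split; [exact: scalar_mx_is_trig | move=> i; rewrite !expr0 mxE eqxx].
split=> [|i].
  apply/is_trig_mxP => i j ltij; rewrite exprS mxE big1 // => l _.
  case: (ltnP i l) => [/trigT ->|leli]; first by rewrite mul0r.
  by rewrite trigTk ?mulr0 // (leq_ltn_trans leli).
rewrite !exprS mxE (bigD1 i) //= diagTk big1 ?addr0 // => l.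
rewrite neq_ltn => /orP[ltli|ltil]; last by rewrite trigT ?mul0r.
by rewrite trigTk ?mulr0.
Qed.

Lemma conjmxX (F : fieldType) n (P A : 'M[F]_n) k :
  P \in unitmx -> P *m A ^+ k *m invmx P = (P *m A *m invmx P) ^+ k.
Proof.
move=> unitP; elim: k => [|k IHk]; first by rewrite !expr0 mulmx1 mulmxV.
by rewrite !exprS -IHk -!mulmxE !mulmxA mulmxKV.
Qed.

(** By Schur, [A] is conjugate to a triangular matrix. Conjugation preserves the trace of [A ^+ k],
    and the diagonal of the triangular power consists of [k]-th powers of eigenvalues of [A]. *)
Lemma norm_mxtrace_exp_le (C : numClosedFieldType) n (A : 'M[C]_n) (r : C) k :
  (forall a, eigenvalue A a -> `|a| <= r) -> `|\tr (A ^+ k)| <= n%:R * r ^+ k.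
Proof.
move=> le_r; case: (posnP n) => [n0|n_gt0].
  rewrite /mxtrace big1 ?normr0 ?n0 ?mul0r // => i _.
  by move: (ltn_ord i); rewrite {2}n0.
have [P /unitarymx_unit unitP] := Schur A n_gt0.
rewrite /similar_to conjumx // => trigT.
have -> : \tr (A ^+ k) = \tr ((P *m A *m invmx P) ^+ k).
  by rewrite -conjmxX // mxtrace_mulC mulmxA mulVmx // mul1mx.
have [_ diagT] := trig_mxX k trigT.
rewrite /mxtrace; apply: le_trans (ler_norm_sum _ _ _) _.
have -> : n%:R * r ^+ k = \sum_(i < n) r ^+ k.
  by rewrite sumr_const card_ord mulr_natl.
apply: ler_sum => i _; rewrite diagT normrX lerXn2r ?nnegrE //.
  (* Nonnegativity of [r] comes from the existence of an eigenvalue, whose norm [r] bounds. *)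
  have [a /le_r] := eigenvalue_closed A n_gt0.
  exact: le_trans (normr_ge0 a).
apply: le_r; suff : eigenvalue (conjmx P A) ((P *m A *m invmx P) i i).
  by apply: eigenvalue_conjmx; rewrite ?row_free_unit // stablemx_unit.
rewrite conjumx // eigenvalue_root_char char_poly_trig // rootE horner_prod.
by rewrite (bigD1 i) //= hornerXsubC subrr mul0r.
Qed.

Lemma eigenvalueX (F : fieldType) n (A : 'M[F]_n) a k :
  eigenvalue A a -> eigenvalue (A ^+ k) (a ^+ k).
Proof.
move=> /eigenvalueP[v vA v0]; apply/eigenvalueP; exists v => //.
elim: k => [|k IHk]; first by rewrite !expr0 mulmx1 scale1r.
by rewrite !exprS -mulmxE mulmxA vA -scalemxAl IHk scalerA.
Qed.

(** Eigenvectors are row vectors, so comparing the l1 norms of the two sides of [v *m A = a *: v]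
    brings in the row sums of [A]. *)
Lemma norm_eigenvalue_le (F : numFieldType) n (A : 'M[F]_n) (a c : F) :
  (forall i, \sum_j `|A i j| <= c) -> eigenvalue A a -> `|a| <= c.
Proof.
move=> le_c /eigenvalueP[v vA v0].
have sum_gt0 : 0 < \sum_j `|v 0 j|.
  rewrite lt_def sumr_ge0 // andbT; apply: contra v0 => /eqP sum0.
  apply/eqP/rowP => j; rewrite mxE; apply/normr0_eq0.
  by apply: (psumr_eq0P _ sum0).
rewrite -(ler_pM2r sum_gt0) mulr_sumr.
have -> : \sum_j `|a| * `|v 0 j| = \sum_j `|\sum_i v 0 i * A i j|.
  apply: eq_bigr => j _; rewrite -normrM.
  by move/rowP: vA => /(_ j); rewrite !mxE => ->.
apply: (@le_trans _ _ (\sum_j \sum_i `|v 0 i| * `|A i j|)).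
  apply: ler_sum => j _; apply: le_trans (ler_norm_sum _ _ _) _.
  by apply: ler_sum => i _; rewrite normrM.
rewrite exchange_big mulr_sumr; apply: ler_sum => i _ /=.
by rewrite -mulr_sumr mulrC ler_wpM2r.
Qed.


(** * Spectral radius of a real matrix through its complex eigenvalues *)

Section SpectralRadius.
Variables (R : realType) (n : nat) (B : 'M[R]_n).
Local Notation toC := (map_mx (real_complex R)).
Local Notation normc := ComplexField.Normc.normc.

Lemma normC_normc (z : complex R) : `|z| = (normc z)%:C%C.
Proof. by case: z => a b; rewrite normc_def. Qed.

Lemma normc_ge0 (z : complex R) : 0 <= normc z.
Proof. by rewrite -ler0c -normC_normc. Qed.

Lemma map_real_complexX k : toC (B ^+ k) = toC B ^+ k.
Proof.
elim: k => [|k IHk]; first by rewrite !expr0 map_mx1.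
by rewrite !exprS -IHk -!mulmxE map_mxM.
Qed.

Lemma normc_eigenvalueX_le (c : R) (z : complex R) k :
  (forall i, \sum_j `|(B ^+ k) i j| <= c) ->
  eigenvalue (toC B) z -> normc z ^+ k <= c.
Proof.
move=> le_c /(@eigenvalueX _ _ _ _ k); rewrite -map_real_complexX => Bz.
rewrite -lecR rmorphXn /= -normC_normc -normrX.
apply: norm_eigenvalue_le Bz => i.
have -> : \sum_j `|toC (B ^+ k) i j| = (\sum_j `|(B ^+ k) i j|)%:C%C.
  rewrite rmorph_sum; apply: eq_bigr => j _ /=.
  by rewrite mxE normC_normc /= expr0n addr0 sqrtr_sqr.
by rewrite lecR.
Qed.

(** The [sup] is an upper bound only if its set is bounded: the sum of all [|B i j|] dominates every
    row sum, hence every eigenvalue. *)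
Lemma normc_le_spectral_radius (z : complex R) :
  eigenvalue (toC B) z -> normc z <= spectral_radius B.
Proof.
move=> Bz; apply: ub_le_sup; last by exists z.
exists (\sum_i \sum_j `|B i j|) => _ [y /= By <-].
rewrite -[normc y]expr1; apply: normc_eigenvalueX_le By => i.
rewrite expr1 [leRHS](bigD1 i) //= lerDl.
by apply: sumr_ge0 => ? _; apply: sumr_ge0.
Qed.

Lemma normr_mxtrace_exp_le k :
  `|\tr (B ^+ k)| <= n%:R * spectral_radius B ^+ k.
Proof.
have le_rho z : eigenvalue (toC B) z -> `|z| <= (spectral_radius B)%:C%C.
  by rewrite normC_normc lecR; exact: normc_le_spectral_radius.
have := norm_mxtrace_exp_le k le_rho.
rewrite -map_real_complexX trace_map_mx -rmorphXn /=.
rewrite -(rmorph_nat (real_complex R)).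
by rewrite -rmorphM /= normC_normc /= expr0n addr0 sqrtr_sqr lecR.
Qed.

Hypothesis n_gt0 : (0 < n)%N.

Lemma spectral_radius_ge0 : 0 <= spectral_radius B.
Proof.
have [z /normc_le_spectral_radius] := eigenvalue_closed (toC B) n_gt0.
exact: le_trans (normc_ge0 z).
Qed.

Lemma spectral_radius_lt1 (c : R) k : c < 1 ->
  (forall i, \sum_j `|(B ^+ k) i j| <= c) -> spectral_radius B < 1.
Proof.
(* Exponent zero is contradictory: the rows of the identity sum to 1, which exceeds [c]. *)
move=> c_lt1 le_c; case: k le_c => [|k] le_c.
  have := le_c (Ordinal n_gt0); rewrite expr0 (bigD1 (Ordinal n_gt0)) //=.
  rewrite mxE eqxx normr1 => le1c; suff : (1 : R) < 1 by rewrite ltxx.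
  by apply: le_lt_trans c_lt1; apply: le_trans le1c; rewrite lerDl sumr_ge0.
have c_ge0 : 0 <= c.
  by apply: le_trans (le_c (Ordinal n_gt0)); apply: sumr_ge0.
have rootX : (c `^ k.+1%:R^-1) ^+ k.+1 = c.
  by rewrite -powR_mulrn ?powR_ge0 // -powRrM mulVf ?pnatr_eq0 // powRr1.
(* The root of [c] bounds all eigenvalues at once, so strictness survives the [sup]. *)
have le_root : spectral_radius B <= c `^ k.+1%:R^-1.
  apply: ge_sup => [|_ [z /= Bz <-]].
    by have [z Bz] := eigenvalue_closed (toC B) n_gt0; exists (normc z), z.
  rewrite -(@ler_pXn2r _ k.+1) ?nnegrE ?normc_ge0 ?powR_ge0 // rootX.
  exact: normc_eigenvalueX_le Bz.
apply: le_lt_trans le_root _.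
by rewrite -(@ltr_pXn2r _ k.+1) ?nnegrE ?powR_ge0 // rootX expr1n.
Qed.

End SpectralRadius.

(** * Powers of irreducible nonnegative matrices *)

Section IrreducibleMatrix.
Variables (R : realType) (n : nat) (B : 'M[R]_n).
Hypotheses (n_gt0 : (0 < n)%N) (B_ge0 : forall i j, 0 <= B i j).
Hypothesis B_irr : forall i j, exists k, 0 < (B ^+ k.+1) i j.

Lemma nonneg_mxX k i j : 0 <= (B ^+ k) i j.
Proof.
elim: k i j => [|k IHk] i j; first by rewrite expr0 mxE ler0n.
by rewrite exprS mxE sumr_ge0 // => l _; rewrite mulr_ge0.
Qed.

Lemma mxX_mul_le k l i j m : (B ^+ k) i j * (B ^+ l) j m <= (B ^+ (k + l)) i m.
Proof.
rewrite exprD mxE (bigD1 j) //= lerDl.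
by apply: sumr_ge0 => ? _; rewrite mulr_ge0 ?nonneg_mxX.
Qed.

Lemma mxX_diag_le k i : (B ^+ k) i i <= n%:R * spectral_radius B ^+ k.
Proof.
apply: le_trans (normr_mxtrace_exp_le B k); apply: le_trans (ler_norm _).
rewrite /mxtrace (bigD1 i) //= lerDl.
by apply: sumr_ge0 => ? _; rewrite nonneg_mxX.
Qed.

Lemma irreducible_spectral_radius_gt0 : 0 < spectral_radius B.
Proof.
rewrite lt_def spectral_radius_ge0 // andbT; apply/eqP => rho0.
(* The exponent is a successor, so a zero spectral radius makes the bound on this positive diagonal
   entry vanish. *)
have [k] := B_irr (Ordinal n_gt0) (Ordinal n_gt0).
by rewrite ltNge (le_trans (mxX_diag_le _ _)) // rho0 exprS mul0r mulr0.
Qed.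

(* Closing up with a fixed return path from [j] to [i] turns any entry into a
   diagonal one, which is controlled by the trace. *)
Lemma irreducible_mxX_le : exists C : R, 0 < C /\
  forall k i j, (B ^+ k) i j <= C * spectral_radius B ^+ k.
Proof.
have [r r_gt0] := boolp.choice (fun ij : 'I_n * 'I_n => B_irr ij.2 ij.1).
(* For [ij = (i, j)], the exponent [(r ij).+1] is the length of the return path from [j] to [i];
   dividing the diagonal bound by the return entry isolates [(B ^+ k) i j]. *)
pose bound ij := n%:R * spectral_radius B ^+ (r ij).+1 /
  (B ^+ (r ij).+1) ij.2 ij.1.
have bound_ge0 ij : 0 <= bound ij.
  by rewrite divr_ge0 ?mulr_ge0 ?ler0n ?exprn_ge0 ?spectral_radius_ge0 // ltW.
(* Summing over all pairs makes the constant uniform; the 1 makes it positive. *)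
exists (1 + \sum_ij bound ij).
have sum_ge0 : 0 <= \sum_ij bound ij by apply: sumr_ge0.
split=> [|k i j]; first by rewrite ltr_pwDl.
apply: (@le_trans _ _ (bound (i, j) * spectral_radius B ^+ k)).
  rewrite mulrAC ler_pdivlMr //; apply: le_trans (mxX_mul_le _ _ _ _ _) _.
  by rewrite -mulrA -exprD addnC mxX_diag_le.
rewrite ler_wpM2r ?exprn_ge0 ?spectral_radius_ge0 //.
rewrite (bigD1 (i, j)) //= addrCA lerDl addr_ge0 //.
by apply: sumr_ge0.
Qed.

Hypothesis B_row_le1 : forall i, \sum_j B i j <= 1.

Let row_sumS k i :
  \sum_j (B ^+ k.+1) i j = \sum_l (B ^+ k) i l * \sum_j B l j.
Proof.
under eq_bigr do rewrite exprSr mxE.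
by rewrite exchange_big; apply: eq_bigr => l _; rewrite mulr_sumr.
Qed.

Let row_sum_nonincr i k l : (k <= l)%N ->
  \sum_j (B ^+ l) i j <= \sum_j (B ^+ k) i j.
Proof.
move=> /subnK <-; elim: (l - k)%N => // m; apply: le_trans.
rewrite addSn row_sumS; apply: ler_sum => j _.
by rewrite ler_piMr ?nonneg_mxX.
Qed.

(** If [i] reaches [i0] in [k.+1] steps, one further step loses mass at [i0], so row [i] of
    [B ^+ k.+2] sums to less than 1. Since row sums never increase with the exponent, one large
    exponent serves all rows. *)
Lemma substochastic_spectral_radius_lt1 i0 :
  \sum_j B i0 j < 1 -> spectral_radius B < 1.
Proof.
move=> i0_lt1.
have /boolp.choice[K K_lt1] i : exists k, \sum_j (B ^+ k) i j < 1.
  have [k k_gt0] := B_irr i i0; exists k.+2.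
  apply: (@lt_le_trans _ _ (\sum_j (B ^+ k.+1) i j)).
    rewrite row_sumS [ltLHS](bigD1 i0) //= [ltRHS](bigD1 i0) //=.
    apply: ltr_leD; first by rewrite gtr_pMr.
    by apply: ler_sum => l _; rewrite ler_piMr ?nonneg_mxX.
  apply: le_trans (row_sum_nonincr i (leq0n _)) _.
  rewrite expr0 (bigD1 i) //= mxE eqxx big1 ?addr0 // => j ji.
  by rewrite mxE eq_sym (negPf ji).
(* The exponent [\sum_i K i] is at least each [K i]; the largest row sum then serves as the bound
   [c < 1]. *)
pose row_sum i := \sum_j (B ^+ (\sum_i K i)) i j.
pose i1 := [arg max_(i > i0) row_sum i]%O.
apply: (@spectral_radius_lt1 _ _ B n_gt0 (row_sum i1) (\sum_i K i)%N).
  apply: le_lt_trans (K_lt1 i1); apply: row_sum_nonincr.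
  by rewrite (bigD1 i1) //= leq_addr.
move=> i; rewrite (eq_bigr (fun j => (B ^+ (\sum_i K i)) i j)); last first.
  by move=> j _; rewrite ger0_norm ?nonneg_mxX.
by rewrite /i1; case: arg_maxP => // ? _; apply.
Qed.

End IrreducibleMatrix.

(** * The squared transition matrix of an automaton *)

Section AutomatonMatrix.
Variables (R : realType) (A Q : finType) (M : markov_automaton R A Q).
Local Notation B := (sq_transition_mx M).

Lemma sq_transition_mxE i j : B i j =
  if step M (enum_val i).1 (enum_val j).2 == Some (enum_val j).1
  then trans M (enum_val i).1 (enum_val j).2 ^+ 2 else 0.
Proof.
rewrite !mxE; case: (enum_val i) => p a; case: (enum_val j) => q b /=.
by case: ifP => // _; rewrite expr0n.
Qed.

Lemma sq_transition_mx_ge0 i j : 0 <= B i j.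
Proof. by rewrite sq_transition_mxE; case: ifP => // _; rewrite sqr_ge0. Qed.

Lemma trans_gt0 p a : step M p a != None -> 0 < trans M p a.
Proof.
move=> step_pa; rewrite lt_def trans_ge0 andbT.
by apply: contra_neq step_pa => /trans_eq0.
Qed.

Lemma step_entering p a q : step M p a = Some q ->
  exists i : 'I_#|entering M|, enum_val i = (q, a).
Proof.
move=> step_pa; have qa_in : (q, a) \in entering M.
  by rewrite inE; apply/existsP; exists p; rewrite /= step_pa.
by exists (enum_rank_in qa_in (q, a)); rewrite enum_rankK_in.
Qed.

Lemma step_defined p : exists a, step M p a != None.
Proof.
apply/existsP; apply: contraT => /existsPn stepN.
suff : (1 : R) = 0 by move/eqP; rewrite oner_eq0.
rewrite -(trans_sum1 M p) big1 // => a _.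
by apply/trans_eq0/eqP/negPn/stepN.
Qed.

(** By determinism [v] labels at most one path from a given state, and its squared weight is one of
    the nonnegative terms in the expansion of the matrix power. If the path breaks off, the weight
    is 0 and any column will do. *)
Lemma path_weight_sqr_le v i : exists j,
  path_weight M (enum_val i).1 v ^+ 2 <= (B ^+ size v) i j.
Proof.
elim: v i => [|x v IHv] i /=.
  by exists i; rewrite expr0 mxE eqxx expr1n.
case step_x : (step M _ x) => [q|]; last first.
  by exists i; rewrite mulr0 expr0n nonneg_mxX //; exact: sq_transition_mx_ge0.
have [k def_k] := step_entering step_x; have [j le_j] := IHv k; exists j.
rewrite -[(size v).+1]add1n.
apply: le_trans (mxX_mul_le sq_transition_mx_ge0 _ _ i k j).
rewrite exprMn expr1 sq_transition_mxE def_k /= step_x eqxx.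
by rewrite ler_wpM2l ?sqr_ge0 //; rewrite def_k in le_j.
Qed.

(** Extend the sum from [entering M] to all pairs of a state and a letter; each letter then
    contributes at most once, at its unique target. *)
Lemma sq_transition_mx_row_le i :
  \sum_j B i j <= \sum_a trans M (enum_val i).1 a ^+ 2.
Proof.
set p := (enum_val i).1.
pose F (qa : Q * letter A) :=
  if step M p qa.2 == Some qa.1 then trans M p qa.2 ^+ 2 else 0.
have F_ge0 qa : 0 <= F qa by rewrite /F; case: ifP => // _; rewrite sqr_ge0.
apply: (@le_trans _ _ (\sum_qa F qa)).
  have -> : \sum_j B i j = \sum_(qa in entering M) F qa.
    rewrite [RHS]big_enum_val; apply: eq_bigr => j _.
    by rewrite sq_transition_mxE.
  by rewrite [leRHS](bigID (mem (entering M))) lerDl sumr_ge0.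
rewrite -(pair_bigA _ (fun q a => F (q, a))) exchange_big /=.
apply: ler_sum => a _; rewrite /F /=; case: (step M p a) => [q|]; last first.
  by rewrite big1 ?sqr_ge0.
rewrite (bigD1 q) //= eqxx big1 ?addr0 // => q' q'q.
by rewrite (inj_eq Some_inj) eq_sym (negPf q'q).
Qed.

Lemma trans_le1 p a : trans M p a <= 1.
Proof.
rewrite -(trans_sum1 M p) (bigD1 a) //= lerDl.
by apply: sumr_ge0 => b _; exact: trans_ge0.
Qed.

Lemma trans_sqr_le p a : trans M p a ^+ 2 <= trans M p a.
Proof. by rewrite expr2 ler_piMr ?trans_ge0 ?trans_le1. Qed.

Lemma sq_transition_mx_row_le1 i : \sum_j B i j <= 1.
Proof.
apply: le_trans (sq_transition_mx_row_le i) _.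
rewrite -(trans_sum1 M (enum_val i).1).
by apply: ler_sum => a _; exact: trans_sqr_le.
Qed.

Lemma sum_trans_sqr_lt1 p a b : a != b ->
  step M p a != None -> step M p b != None -> \sum_c trans M p c ^+ 2 < 1.
Proof.
move=> ab /trans_gt0 a_gt0 /trans_gt0 b_gt0.
have sum1 := trans_sum1 M p.
rewrite (bigD1 a) //= in sum1.
have a_lt1 : trans M p a < 1.
  rewrite -sum1 ltrDl (bigD1 b) 1?eq_sym //= ltr_pwDl //.
  by apply: sumr_ge0 => c _; exact: trans_ge0.
rewrite -sum1 (bigD1 a) //= ltr_leD //; first by rewrite expr2 gtr_pMr.
by apply: ler_sum => c _; exact: trans_sqr_le.
Qed.

Hypothesis M_irr : irreducible M.

(** As [connect] is reflexive, a path from [q] to itself may be empty. Hence the detour through a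
    successor [p] of [q]: the last edge of a path from [p] to [q] enters [q], and if that path is
    empty, [p = q] carries a loop. *)
Lemma irreducible_predecessor q : exists p a, step M p a = Some q.
Proof.
have [a] := step_defined q; case step_a : (step M q a) => [p|//] _.
case/connectP: (M_irr p q) => s.
elim/last_ind: s => [_ /= eq_qp|s r _]; first by exists q, a; rewrite {2}eq_qp.
rewrite rcons_path last_rcons => /andP[_ /existsP[b /eqP step_b]] ->.
by exists (last p s), b.
Qed.

Lemma state_entering q : exists i : 'I_#|entering M|, (enum_val i).1 = q.
Proof.
have [p [a /step_entering[i def_i]]] := irreducible_predecessor q.
by exists i; rewrite def_i.
Qed.

Lemma sq_transition_mx_gt0 i j :
  step M (enum_val i).1 (enum_val j).2 = Some (enum_val j).1 -> 0 < B i j.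
Proof.
move=> step_ij; rewrite sq_transition_mxE step_ij eqxx exprn_gt0 //.
by rewrite trans_gt0 // step_ij.
Qed.

(** The path prescribes only states, so the letter component of the final index [l] is left free. *)
Lemma path_mxX_gt0 s i : path (edge M) (enum_val i).1 s ->
  exists k l, (enum_val l).1 = last (enum_val i).1 s /\ 0 < (B ^+ k) i l.
Proof.
elim: s i => [|q s IHs] i /=.
  by exists 0%N, i; rewrite expr0 mxE eqxx ltr01.
case/andP => /existsP[a /eqP step_a].
have [j def_j] := step_entering step_a.
have := IHs j; rewrite def_j /= => IHj /IHj[k [l [last_l k_gt0]]].
exists k.+1, l; split=> //; rewrite -add1n.
apply: lt_le_trans (mxX_mul_le sq_transition_mx_ge0 _ _ i j l).
by rewrite mulr_gt0 // expr1 sq_transition_mx_gt0 ?def_j.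
Qed.

(** An index [j] fixes both the final state and the last letter read. The path therefore goes to a
    state [p] from which that letter leads to that state, and this transition is appended. *)
Lemma sq_transition_mx_irreducible i j : exists k, 0 < (B ^+ k.+1) i j.
Proof.
have := enum_valP j; rewrite inE => /existsP[p /eqP step_p].
case/connectP: (M_irr (enum_val i).1 p) => s.
case/path_mxX_gt0 => k [l [last_l k_gt0]] def_p.
exists k; rewrite -addn1.
apply: lt_le_trans (mxX_mul_le sq_transition_mx_ge0 _ _ i l j).
by rewrite mulr_gt0 // expr1 sq_transition_mx_gt0 // last_l -def_p.
Qed.

Lemma coincidence_prob_gt0 : (0 < #|Q|)%N -> 0 < coincidence_prob M.
Proof.
move=> /card_gt0P[q _]; have [i _] := state_entering q.
have n_gt0 := leq_ltn_trans (leq0n i) (ltn_ord i).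
apply: irreducible_spectral_radius_gt0 n_gt0 _ _.
  exact: sq_transition_mx_ge0.
exact: sq_transition_mx_irreducible.
Qed.

Lemma coincidence_prob_lt1 : ~ single_cycle M -> coincidence_prob M < 1.
Proof.
move=> not_cycle.
(* Irreducibility being given, only the count of outgoing transitions can fail. It is never 0,
   because probabilities sum to 1, so some state has at least two. *)
have [q q_branch] : exists q, #|[set a | step M q a != None]%SET| != 1%N.
  apply: boolp.contrapT => /boolp.forallNP card1; apply: not_cycle.
  split=> // q.
  by apply/eqP/negPn/negP/card1.
have /card_gt1P[a [b [step_a step_b ab]]] :
    (1 < #|[set a | step M q a != None]%SET|)%N.
  rewrite ltn_neqAle eq_sym q_branch card_gt0; apply/set0Pn.
  by have [a] := step_defined q; exists a; rewrite inE.
rewrite !inE in step_a step_b.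
have [i def_i] := state_entering q.
have n_gt0 := leq_ltn_trans (leq0n i) (ltn_ord i).
apply: (substochastic_spectral_radius_lt1 n_gt0 _ _ _ (i0 := i)).
- exact: sq_transition_mx_ge0.
- exact: sq_transition_mx_irreducible.
- exact: sq_transition_mx_row_le1.
apply: le_lt_trans (sq_transition_mx_row_le i) _.
by rewrite def_i; apply: sum_trans_sqr_lt1 ab step_a step_b.
Qed.

Lemma path_weight_le : (0 < #|Q|)%N -> exists C : R, 1 <= C /\
  forall q v, path_weight M q v <= C * Num.sqrt (coincidence_prob M) ^+ size v.
Proof.
move=> /card_gt0P[q0 _]; have [i0 _] := state_entering q0.
have n_gt0 := leq_ltn_trans (leq0n i0) (ltn_ord i0).
have [C [C_gt0 le_C]] :=
  irreducible_mxX_le n_gt0 sq_transition_mx_ge0 sq_transition_mx_irreducible.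
have rho_ge0 : 0 <= coincidence_prob M by exact: spectral_radius_ge0.
(* The entry bound controls the squared weight, whence the square root; the 1 secures a constant of
   at least 1. *)
exists (1 + Num.sqrt C); split=> [|q v]; first by rewrite lerDl sqrtr_ge0.
have [i <-] := state_entering q; have [j le_j] := path_weight_sqr_le v i.
apply: (@le_trans _ _ (Num.sqrt C * Num.sqrt (coincidence_prob M) ^+ size v)).
  rewrite -ler_sqr ?nnegrE ?path_weight_ge0 ?mulr_ge0 ?exprn_ge0 ?sqrtr_ge0 //.
  apply: le_trans le_j _; apply: le_trans (le_C _ _ _) _.
  by rewrite exprMn exprAC !sqr_sqrtr // ltW.
by rewrite ler_wpM2r ?exprn_ge0 ?sqrtr_ge0 // lerDr.
Qed.

End AutomatonMatrix.

(** * Prefix cylinders and conditional probabilities *)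

Section PrefixMeasure.
Variables (R : realType) (A Q : finType) (M : markov_automaton R A Q).

(** Reading [u] leads to some state, and [K] bounds the weight of [v] from every state. *)
Lemma path_weight_cat_le (K : R) v : 0 <= K ->
  (forall q, path_weight M q v <= K) ->
  forall q u, path_weight M q (u ++ v) <= K * path_weight M q u.
Proof.
move=> K_ge0 le_K q u; elim: u q => [|x u IHu] q /=; first by rewrite mulr1.
rewrite mulrCA ler_wpM2l ?trans_ge0 //.
by case: (step M q x) => [q'|]; rewrite ?mulr0.
Qed.

Lemma word_weight_cat_le (K : R) v : 0 <= K ->
  (forall q, path_weight M q v <= K) ->
  forall u, word_weight M (u ++ v) <= K * word_weight M u.
Proof.
move=> K_ge0 le_K u; rewrite mulr_sumr; apply: ler_sum => q _.
by rewrite mulrCA ler_wpM2l ?init_ge0 // path_weight_cat_le.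
Qed.

(** The weights of all completions of [u] to length [n] sum to 1; if [u] is longer than [n] there
    are none, which the boolean factor records. *)
Lemma sum_path_weight_prefix n u q :
  \sum_(w : n.-tuple (letter A)) path_weight M q w * (prefix u w)%:R =
  path_weight M q u * (size u <= n)%N%:R.
Proof.
elim: n u q => [|n IHn] [|x u] q /=.
- by rewrite (big_pred1 [tuple]) // => w; rewrite [w]tuple0 /= eqxx.
- by rewrite mulr0 big1 // => w _; rewrite [w]tuple0 mulr0.
- by under eq_bigr do rewrite prefix0s mulr1; rewrite sum_path_weight mulr1.
rewrite (reindex (fun p : letter A * n.-tuple (letter A) =>
  [tuple of p.1 :: p.2])) /=; last first.
  exists (fun w => (thead w, [tuple of behead w])) => [[a w] _|w _] /=.
    by congr pair; apply: val_inj.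
  by rewrite -tuple_eta.
rewrite -(pair_bigA _ (fun a (w : n.-tuple (letter A)) =>
  path_weight M q (a :: w) * (prefix (x :: u) (a :: w))%:R)) /=.
rewrite (bigD1 x) //= [X in _ + X]big1 ?addr0 => [|a ax]; last first.
  by rewrite big1 // => w _; rewrite eq_sym (negPf ax) mulr0.
rewrite ltnS eqxx /=; case: (step M q x) => [q'|]; last first.
  by rewrite mulr0 mul0r big1 // => w _; rewrite mul0r.
by rewrite -mulrA -IHn mulr_sumr; apply: eq_bigr => w _; rewrite mulrA.
Qed.

Lemma sum_word_weight_prefix n u :
  \sum_(w : n.-tuple (letter A)) word_weight M w * (prefix u w)%:R =
  word_weight M u * (size u <= n)%N%:R.
Proof.
under eq_bigr do rewrite mulr_suml.
rewrite exchange_big mulr_suml; apply: eq_bigr => q _ /=.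
under eq_bigr do rewrite -mulrA.
by rewrite -mulr_sumr sum_path_weight_prefix mulrA.
Qed.

Hypothesis M_red : support_reduced M.

(** Words that are not reduced have weight 0, so restricting the cylinder to reduced words leaves
    its mass unchanged. *)
Lemma word_prob_prefix n u :
  word_prob M n (reduced_with_prefix u) =
  (word_weight M u * (size u <= n)%N%:R)%:E.
Proof.
rewrite -sum_word_weight_prefix -sumEFin; apply: eq_bigr => w _.
rewrite diracE -EFinM; congr (_ %:E).
have [->|/M_red red_w] := eqVneq (word_weight M w) 0; first by rewrite !mul0r.
congr (_ * _%:R); congr nat_of_bool; apply/idP/idP => [/set_mem[]//|pre_w].
by apply/mem_set; split.
Qed.

Lemma word_prob_support n w : word_prob M n [set w]%classic != 0%E ->
  reduced w /\ size w = n.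
Proof.
move=> prob_w.
have [t] : exists t : n.-tuple (letter A),
    ((word_weight M t)%:E * \d_(t : word A) [set w]%classic)%E != 0%E.
  apply/existsP; apply: contraNT prob_w => /existsPn all0.
  by apply/eqP; apply: big1 => t _; apply/eqP/negPn/all0.
rewrite diracE; case: (boolP (_ \in _)) => [/set_mem <-|_]; last first.
  by rewrite mule0 eqxx.
by rewrite mule1 eqe size_tuple => /M_red.
Qed.

Lemma word_prob_cond_le (K : R) n u v : 0 <= K ->
  (forall q, path_weight M q v <= K) ->
  cond_prob (word_prob M n) (reduced_with_prefix (u ++ v))
    (reduced_with_prefix u) <= K.
Proof.
move=> K_ge0 le_K; rewrite /cond_prob.
have -> : (reduced_with_prefix (u ++ v) `&` reduced_with_prefix u =
    reduced_with_prefix (u ++ v))%classic.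
  by apply: setIidl => w /= [red_w /catl_prefix pre_w]; split.
(* If [u] is longer than [n] or has weight 0, the denominator is 0 and the quotient is 0 by
   convention. *)
rewrite !word_prob_prefix /=; case: (leqP (size u) n) => [_|u_n]; last first.
  by rewrite mulr0 invr0 mulr0.
rewrite mulr1; have [->|u0] := eqVneq (word_weight M u) 0.
  by rewrite invr0 mulr0.
rewrite ler_pdivrMr ?lt_def ?u0 ?word_weight_ge0 //.
apply: le_trans (word_weight_cat_le K_ge0 le_K u).
by rewrite ler_piMr ?word_weight_ge0 // lern1 leq_b1.
Qed.

End PrefixMeasure.

Theorem proposition4p9 (R : realType) (A Q : finType) (hA : (0 < #|A|)%N)
    (hQ : (0 < #|Q|)%N) (M : markov_automaton R A Q)
    (hred : support_reduced M) (hirr : irreducible M)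
    (hcyc : ~ single_cycle M) :
  exists C : R, 0 < C /\
    prefix_heavy (word_prob M) C (Num.sqrt (coincidence_prob M)).
Proof.
have [C [C_ge1 le_C]] := path_weight_le hirr hQ.
have C_gt0 : 0 < C by exact: lt_le_trans C_ge1.
exists C; split=> //; split=> //.
- rewrite sqrtr_gt0 coincidence_prob_gt0 //= -sqrtr1.
  by rewrite ltr_sqrt ?coincidence_prob_lt1.
- by move=> n w; exact: word_prob_support.
move=> n u _ _ v _; apply: word_prob_cond_le => //.
by rewrite mulr_ge0 ?exprn_ge0 ?sqrtr_ge0 // ltW.
Qed.
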